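(* Let $G_{p,q}$ be the grid graph with source $s=v_{1,1}$ and target $t=v_{p,q}$, and let $Y=\begin{pmatrix} X & x \\ x^{\mathrm T} & 1 \end{pmatrix}$ be feasible for $SDP_L$ (for the graph $G_{p,q}$). Let $L=p+q-2$ be the length of the $s$-$t$ paths. Then (i) $Xe=Lx$; (ii) $e^{\mathrm T}Xe=L^2$ and $e^{\mathrm T}Ye=(L+1)^2$, where $e$ denotes the all-ones vector of the appropriate dimension.
   Context: The grid graph $G_{p,q}=(V,A)$ is the directed graph with $$V=\{v_{i,j}: 1\le i\le p,\ 1\le j\le q\},\qquad A=\{(v_{i,j},v_{i',j'}): |i-i'|+|j-j'|=1,\ i'\ge i,\ j'\ge j\},$$ with source $s=v_{1,1}$ and target $t=v_{p,q}$, $s\ne t$. Write $n=|V|$, $m=|A|$. The incidence matrix $\mathcal{I}$ of a directed graph is the $n\times m$ matrix with $\mathcal{I}_{v,e}=1$ if arc $e$ leaves vertex $v$, $-1$ if $e$ enters $v$, and $0$ otherwise; its row indexed by vertex $i$ is denoted $a_i^{\mathrm T}$. The vector $b\in\mathbb{R}^n$ is given by $b_s=1$, $b_t=-1$, and $b_i=0$ otherwise. $Q\in\mathbb{R}^{m\times m}$ is a given nonnegative symmetric matrix. The SDP relaxation $SDP_L$ is: minimize $\langle Q,X\rangle$ over symmetric $X\in\mathbb{R}^{m\times m}$ and $x\in\mathbb{R}^m$ subject to $$a_s^{\mathrm T}x=b_s,\quad \operatorname{diag}(X)=x,\quad \begin{pmatrix} X & x \\ x^{\mathrm T} & 1 \end{pmatrix}\succeq0,\quad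 \langle a_ia_i^{\mathrm T},X\rangle=b_i^2\ \ \forall i\in V\setminus\{t\}.$$ The matrix $Y=\begin{pmatrix} X & x \\ x^{\mathrm T} & 1 \end{pmatrix}$ is called feasible for $SDP_L$ if $(X,x)$ satisfies these constraints. Here $\langle M,N\rangle=\operatorname{trace}(M^{\mathrm T}N)$, $\operatorname{diag}(X)$ is the vector of diagonal entries of $X$, and $\succeq0$ means symmetric positive semidefinite. *)

(* Defs.v *)
From mathcomp Require Import all_boot all_order all_algebra.
From mathcomp Require Import reals.

Set Implicit Arguments.
Unset Strict Implicit.
Unset Printing Implicit Defensive.

Import Order.TTheory GRing.Theory Num.Theory.
Local Open Scope ring_scope.

Section GridGraph.
Variables p q : nat.

(* [v_{i,j}] is the pair [(i - 1, j - 1)]. *)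
Definition grid_vertex : finType := ('I_p * 'I_q)%type.

Definition grid_arcs : {set grid_vertex * grid_vertex} :=
  [set a : grid_vertex * grid_vertex |
    [&& `|a.1.1 - a.2.1| + `|a.1.2 - a.2.2| == 1,
       a.1.1 <= a.2.1 & a.1.2 <= a.2.2]]%N.

Hypotheses (hp : (0 < p)%N) (hq : (0 < q)%N).

Definition grid_source : grid_vertex := (Ordinal hp, Ordinal hq).

(* [rev_ord] maps [i] to [p - 1 - i], so this is the pair [(p - 1, q - 1)]. *)
Definition grid_target : grid_vertex :=
  (rev_ord (Ordinal hp), rev_ord (Ordinal hq)).

End GridGraph.

Section MatrixNotions.
Variable R : realType.

Definition ones n : 'cV[R]_n := const_mx 1.

Definition mxinner m n (M N : 'M[R]_(m, n)) : R := \tr (M^T *m N).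

Definition mxdiagonal n (M : 'M[R]_n) : 'cV[R]_n := \col_i M i i.

Definition psdmx n (M : 'M[R]_n) : Prop :=
  M^T = M /\ forall z : 'cV[R]_n, 0 <= (z^T *m M *m z) 0 0.

Definition bordered_mx n (X : 'M[R]_n) (x : 'cV[R]_n) : 'M[R]_(n + 1) :=
  block_mx X x x^T 1%:M.

End MatrixNotions.

(* A directed graph is given by its set of arcs [A]; rows and columns of its
   matrices are indexed along the enumerations of [V] and [A]. *)
Section SDPL.
Variables (R : realType) (V : finType) (A : {set V * V}) (s t : V).

Definition incidence_mx : 'M[R]_(#|V|, #|A|) :=
  \matrix_(i < #|V|, k < #|A|)
    (if (enum_val k).1 == enum_val i then 1
     else if (enum_val k).2 == enum_val i then -1 else 0).

Definition incidence_vec (v : V) : 'cV[R]_#|A| :=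
  (row (enum_rank v) incidence_mx)^T.

Definition supply (v : V) : R :=
  if v == s then 1 else if v == t then -1 else 0.

Record SDPL_feasible (X : 'M[R]_#|A|) (x : 'cV[R]_#|A|) : Prop := {
  SDPL_sym : X^T = X;
  SDPL_source : ((incidence_vec s)^T *m x) 0 0 = supply s;
  SDPL_diag : mxdiagonal X = x;
  SDPL_psd : psdmx (bordered_mx X x);
  SDPL_flow : forall v : V, v != t ->
    mxinner (incidence_vec v *m (incidence_vec v)^T) X = supply v ^+ 2
}.

End SDPL.

(* Main.v *)
(* A positive semidefinite form that vanishes at a vector has it in its kernel.
   For v <> t the constraints say that Y vanishes at (a_v, - b_v), hence
   X a_v = b_v x and a_v^T x = b_v.  If a potential h on the vertices drops by
   1 along every arc, then e = \sum_v h(v) a_v; on the grid, take for h(v) the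
   distance from v to t, so that h(t) = 0 removes the vertex without constraint.
   Then X e = (\sum_v h(v) b_v) x = h(s) x = L x, and e^T x = L likewise. *)
Require Import Defs.
From mathcomp Require Import all_boot all_order all_algebra.
From mathcomp Require Import reals.
From mathcomp Require Import zify ring.

Set Implicit Arguments.
Unset Strict Implicit.
Unset Printing Implicit Defensive.

Import Order.TTheory GRing.Theory Num.Theory.
Local Open Scope ring_scope.

Lemma dot_self_eq0 (R : realType) n (y : 'cV[R]_n) :
  (y^T *m y) 0 0 = 0 -> y = 0.
Proof.
rewrite mxE => /eqP; rewrite psumr_eq0; last first.
  by move=> i _; rewrite mxE -expr2 sqr_ge0.
move/allP => y0; apply/colP => i; have := y0 i (mem_index_enum i).
by rewrite !mxE -expr2 sqrf_eq0 => /eqP.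
Qed.

(** Move from [z] along [y = M *m z]: by symmetry the form at [z + c *: y] is
    [2 * c * w + c ^+ 2 * b] with [w] the squared norm of [y], which is negative for small negative
    [c] unless [w = 0]. *)
Lemma psdmx_ker (R : realType) n (M : 'M[R]_n) (z : 'cV[R]_n) :
  psdmx M -> (z^T *m M *m z) 0 0 = 0 -> M *m z = 0.
Proof.
case=> symM psdM zMz0; set y := M *m z.
apply: dot_self_eq0; set w := (y^T *m y) 0 0.
set b := (y^T *m M *m y) 0 0.
have b0 : 0 <= b := psdM y.
have expand c : ((z + c *: y)^T *m M *m (z + c *: y)) 0 0
    = 2 * c * w + c ^+ 2 * b.
  have zMy : z^T *m M *m y = y^T *m y by rewrite /y trmx_mul symM.
  rewrite [(_ + _)^T]linearD /= [(_ *: _)^T]linearZ /= !mulmxDl !mulmxDr -!scalemxAl -!scalemxAr.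
  rewrite zMy -(mulmxA y^T M z) -/y !mxE.
  move: zMz0; rewrite mxE => ->.
  rewrite /w /b !mxE; ring.
(* [- w / (b + 1)] avoids the minimizer [- w / b], undefined when [b = 0]. *)
have := psdM (z + (- w / (b + 1)) *: y); rewrite expand.
have -> : 2 * (- w / (b + 1)) * w + (- w / (b + 1)) ^+ 2 * b
    = - (w ^+ 2 * ((b + 2) / (b + 1) ^+ 2)).
  by field; rewrite gt_eqF // ltr_wpDl.
rewrite oppr_ge0 pmulr_lle0; last by rewrite divr_gt0 ?exprn_gt0 // ltr_wpDl.
by move=> w0; apply/eqP; rewrite -sqrf_eq0 eq_le w0 sqr_ge0.
Qed.

Lemma mxinner_dyad (R : realType) n (u : 'cV[R]_n) (M : 'M[R]_n) :
  mxinner (u *m u^T) M = (u^T *m M *m u) 0 0.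
Proof.
rewrite /mxinner trmx_mul trmxK -(mulmxA u).
by rewrite (mxtrace_mulC u) trace_mx11.
Qed.

Lemma quad_bordered (R : realType) n (M : 'M[R]_n) (y u : 'cV[R]_n) (c : R) :
  ((col_mx u c%:M)^T *m bordered_mx M y *m col_mx u c%:M) 0 0
  = (u^T *m M *m u) 0 0 + c * (u^T *m y) 0 0 *+ 2 + c ^+ 2.
Proof.
have yu : y^T *m u = (u^T *m y)^T by rewrite trmx_mul trmxK.
rewrite /bordered_mx tr_col_mx mul_row_block mul_row_col tr_scalar_mx.
rewrite mulmx1 !mulmxDl mul_mx_scalar !mul_scalar_mx -scalemxAl yu.
rewrite scale_scalar_mx !mxE eqxx !mulr1n; ring.
Qed.

Lemma mul_bordered (R : realType) n (M : 'M[R]_n) (y u : 'cV[R]_n) (c : R) :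
  bordered_mx M y *m col_mx u c%:M = col_mx (M *m u + c *: y) (y^T *m u + c%:M).
Proof. by rewrite mul_block_col mul_mx_scalar mul1mx. Qed.

Section Feasible.
Variables (R : realType) (V : finType) (A : {set V * V}) (s t : V).
Variables (X : 'M[R]_#|A|) (x : 'cV[R]_#|A|).
Hypotheses (feasX : SDPL_feasible s t X x).

Let a v : 'cV[R]_#|A| := incidence_vec R A v.
Let b v : R := supply R s t v.

Lemma feasible_ker v : v != t ->
  X *m a v = b v *: x /\ ((a v)^T *m x) 0 0 = b v.
Proof.
move=> vt; have flow := SDPL_flow feasX vt; rewrite mxinner_dyad in flow.
have null : bordered_mx X x *m col_mx (a v) (- b v)%:M = 0.
  apply: psdmx_ker; first exact: (SDPL_psd feasX).
  rewrite quad_bordered flow -/(b v).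
  (* The form at [(a v, - b v)] is now twice [b v ^+ 2] minus twice [b v] times $a_v^T x$. For [v]
     other than [s] and [t], [b v = 0]; at [s] the source constraint gives 1 - 2 + 1. *)
  have [vs|vs] := eqVneq v s; last first.
    by rewrite /b /supply (negPf vs) (negPf vt); ring.
  have bs : b s = 1 by rewrite /b /supply eqxx.
  by rewrite vs (SDPL_source feasX) -/(b s) bs; ring.
move: null; rewrite mul_bordered -col_mx0 => /eq_col_mx[Xa xa].
split; first by apply/eqP; rewrite -subr_eq0 -scaleNr Xa.
apply/eqP; rewrite -subr_eq0 -[_ *m x]trmxK trmx_mul trmxK mxE.
by move/matrixP/(_ 0 0): xa; rewrite !mxE eqxx mulr1n => ->.
Qed.

Variable h : V -> R.
Hypotheses (ht : h t = 0) (hA : forall e, e \in A -> h e.1 - h e.2 = 1).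

(** In the coordinate of an arc [e] only its two ends contribute, and they leave [h e.1 - h e.2]. *)
Lemma ones_potential : ones R #|A| = \sum_v h v *: a v.
Proof.
apply/colP => k; rewrite mxE summxE.
have eA := hA (enum_valP k); set e := enum_val k in eA.
(* A loop would have drop 0. Distinct ends make the entry at the head -1, since the incidence matrix
   tests the tail first. *)
have e12 : e.1 != e.2.
  by apply: contra_eqN eA => /eqP ->; rewrite subrr eq_sym oner_eq0.
rewrite (bigD1 e.1) //= (bigD1 e.2) 1?eq_sym //= big1 => [|v /andP[v1 v2]].
  by rewrite !mxE !enum_rankK -/e !eqxx (negPf e12) -[LHS]eA; ring.
rewrite !mxE enum_rankK -/e [e.1 == v]eq_sym (negPf v1).
by rewrite [e.2 == v]eq_sym (negPf v2) mulr0.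
Qed.

Lemma sum_potential_supply : \sum_v h v * b v = h s.
Proof.
rewrite (bigD1 s) //= big1 => [|v vs]; first by rewrite /b /supply eqxx; ring.
rewrite /b /supply (negPf vs).
by have [->|_] := eqVneq v t; rewrite ?ht ?mul0r ?mulr0.
Qed.

Lemma feasible_mul_ones : X *m ones R _ = h s *: x.
Proof.
rewrite ones_potential mulmx_sumr -sum_potential_supply scaler_suml.
apply: eq_bigr => v _; rewrite -scalemxAr -scalerA.
by have [->|/feasible_ker[-> //]] := eqVneq v t; rewrite ht !scale0r.
Qed.

Lemma feasible_dot_ones : ((ones R _)^T *m x) 0 0 = h s.
Proof.
rewrite ones_potential linear_sum /= mulmx_suml summxE -sum_potential_supply.
apply: eq_bigr => v _; rewrite linearZ /= -scalemxAl mxE.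
by have [->|/feasible_ker[_ -> //]] := eqVneq v t; rewrite ht !mul0r.
Qed.

End Feasible.

Lemma grid_arc_level p q (e : grid_vertex p q * grid_vertex p q) :
  e \in grid_arcs p q -> (e.2.1 + e.2.2 = (e.1.1 + e.1.2).+1)%N.
Proof. rewrite inE => /and3P[/eqP d le1 le2]. lia. Qed.

Theorem lemma5p1 (R : realType) (p q : nat) (hp : (0 < p)%N) (hq : (0 < q)%N)
    (hst : grid_source hp hq != grid_target hp hq)
    (X : 'M[R]_#|grid_arcs p q|) (x : 'cV[R]_#|grid_arcs p q|)
    (hfeas : SDPL_feasible (grid_source hp hq) (grid_target hp hq) X x) :
  let L := (p + q - 2)%N in
  let e n := ones R n in
  let Y := bordered_mx X x in
  X *m e _ = L%:R *: x /\
  (((e _)^T *m X *m e _) 0 0 = L%:R ^+ 2 /\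
   ((e _)^T *m Y *m e _) 0 0 = (L%:R + 1) ^+ 2).
Proof.
move=> L e Y.
pose h (v : grid_vertex p q) : R := L%:R - (v.1 + v.2)%:R.
have ht : h (grid_target hp hq) = 0.
  (* Coordinates start at 0, so the target has level (p - 1) + (q - 1); as [p] and [q] are positive,
     no subtraction truncates. *)
  have lvl : ((grid_target hp hq).1 + (grid_target hp hq).2 = L)%N.
    by rewrite /L /=; lia.
  by rewrite /h lvl subrr.
have hA a : a \in grid_arcs p q -> h a.1 - h a.2 = 1.
  by move=> /grid_arc_level lvl; rewrite /h lvl -addn1 natrD; ring.
have hs : h (grid_source hp hq) = L%:R by rewrite /h subr0.
have Xe := feasible_mul_ones hfeas ht hA.
have ex := feasible_dot_ones hfeas ht hA.
rewrite hs -/(e _) in Xe ex.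
have eXe : ((e _)^T *m X *m e _) 0 0 = L%:R ^+ 2.
  by rewrite -mulmxA Xe -scalemxAr mxE ex expr2.
split=> //; split=> //.
(* Splitting off the last entry lets [quad_bordered] apply with [c = 1], giving $L^2 + 2L + 1$. *)
have -> : e (#|grid_arcs p q| + 1)%N = col_mx (e _) 1%:M.
  rewrite -[LHS]vsubmxK; congr col_mx; apply/colP => i; rewrite !mxE //.
  by rewrite ord1.
by rewrite quad_bordered eXe ex; ring.
Qed.
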